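(* Let $Q$ be a polygonal region and $r>0$, and let $\hat{\varepsilon}:=\inf\{\varepsilon\mid\textsc{Decide}(Q,r,\varepsilon)\text{ returns YES}\}$. Let $0<\varepsilon<\hat{\varepsilon}$ and $0<\delta<\frac{\hat{\varepsilon}-\varepsilon}{2}$. Then $\textsc{ApproxDecideExterior}(Q,r,\varepsilon,\delta)$ returns NO.
   Context: A polygonal region is a (closed) set whose boundary consists of finitely many line segments with disjoint interiors; the input $Q$ is bounded. $D_s(c)$ is the closed disk of radius $s$ around $c$, $D_s:=D_s(0)$, $X^C:=\mathbb{R}^2\setminus X$, $\oplus$ is Minkowski sum, $\mathrm{offset}(X,s):=X\oplus D_s$, $\mathrm{inset}(X,s):=\mathrm{offset}(X^C,s)^C=\{x\mid D_s(x)\subseteq X\}$. $\textsc{Decide}(Q,r,\varepsilon)$ (for $\varepsilon>0$): $Q_\varepsilon:=\mathrm{offset}(Q,\varepsilon)$, $\Pi:=\mathrm{inset}(Q_\varepsilon,r)$, $Q':=\mathrm{offset}(\Pi,r+\varepsilon)$; return YES if $Q\subseteq Q'$, else NO. (For $\varepsilon\ge r$ it returns YES, so $\hat\varepsilon\in[0,r]$.) For $0\le a<b$, $\bar{D}_{a,b}$ denotes a polygon with rational vertices whose boundary lies in the annulus between the circles of radii $a$ and $b$ around the origin, so that $D_a\subseteq\bar{D}_{a,b}\subseteq D_b$. $\textsc{ApproxDecideExterior}(Q,r,\varepsilon,\delta)$: (1) $\widehat{Q_\varepsilon}:=Q\oplus\widehat{D_\varepsilon}$ with $\widehat{D_\varepsilon}:=\bar{D}_{\varepsilon,\varepsilon+\delta}$;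 (2) $\widehat{\Pi}:=(\widehat{Q_\varepsilon}^C\oplus\widehat{D_r})^C$ with $\widehat{D_r}:=\bar{D}_{r-\delta,r}$; (3) $\widehat{Q'}:=\widehat{\Pi}\oplus\widehat{D_{r+\varepsilon}}$ with $\widehat{D_{r+\varepsilon}}:=\bar{D}_{r+\varepsilon,r+\varepsilon+\delta}$; (4) return UNDECIDED if $Q\subseteq\widehat{Q'}$, otherwise NO. *)

(* Defs.v *)
From HB Require Import structures.
From mathcomp Require Import all_boot all_order all_algebra.
From mathcomp Require Import all_classical all_reals all_analysis.

Set Implicit Arguments.
Unset Strict Implicit.
Unset Printing Implicit Defensive.

Import Order.TTheory GRing.Theory Num.Theory.
Import numFieldNormedType.Exports.

Local Open Scope classical_set_scope.
Local Open Scope ring_scope.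

(* The library norm `|x| on 'rV[R]_2 is the sup norm.  It induces the usual
   topology and the usual bounded sets, and is used only through these; disks
   are defined with the Euclidean norm [enorm]. *)
Notation plane R := 'rV[R]_2.

Definition enorm (R : realType) (x : plane R) : R :=
  Num.sqrt (\sum_(i < 2) x ord0 i ^+ 2).

Definition disk (R : realType) (c : plane R) (s : R) : set (plane R) :=
  [set x | enorm (x - c) <= s].

Definition minkowski (R : realType) (A B : set (plane R)) : set (plane R) :=
  [set a + b | a in A & b in B].

Definition offset (R : realType) (X : set (plane R)) (s : R) : set (plane R) :=
  minkowski X (disk 0 s).

Definition inset (R : realType) (X : set (plane R)) (s : R) : set (plane R) :=
  ~` offset (~` X) s.

Lemma insetE (R : realType) (X : set (plane R)) (s : R) :
  inset X s = [set x | disk x s `<=` X].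
Proof.
have enormN (v : plane R) : enorm (- v) = enorm v.
  by congr Num.sqrt; apply: eq_bigr => i _; rewrite mxE sqrrN.
apply/seteqP; split => x /=.
- move=> nx y yx; apply: contrapT => nXy; apply: nx.
  exists y => //; exists (x - y); last by rewrite addrC subrK.
  by rewrite /disk /= subr0 -opprB enormN.
- move=> xX [y nXy [b]]; rewrite /disk /= subr0 => bs yx; apply: nXy; apply: xX.
  by rewrite /disk /= -yx opprD addrA subrr sub0r enormN.
Qed.

Definition boundary (R : realType) (A : set (plane R)) : set (plane R) :=
  closure A `\` interior A.

(* The points (1 - t) a + t b with t in I: the closed segment [a, b] for
   I = `[0, 1], its relative interior for I = `]0, 1[, and the segment without
   its endpoint b for I = `[0, 1[. *)
Definition subsegment (R : realType) (I : interval R) (a b : plane R) :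
    set (plane R) :=
  [set (1 - t) *: a + t *: b | t in [set` I]].

Definition segment (R : realType) : plane R -> plane R -> set (plane R) :=
  subsegment `[0, 1].

Definition open_segment (R : realType) : plane R -> plane R -> set (plane R) :=
  subsegment `]0, 1[.

(* Boundedness is not part of this notion: it is a separate assumption on the
   input of the algorithms. *)
Definition polygonal_region (R : realType) (X : set (plane R)) : Prop :=
  closed X /\
  exists (n : nat) (a b : 'I_n -> plane R),
    [/\ forall i, a i != b i,
        forall i j, i != j -> open_segment (a i) (b i) `&` open_segment (a j) (b j) = set0
      & boundary X = \bigcup_i segment (a i) (b i)].

(* P is the region enclosed by the closed polygonal curve through the vertices
   v 0, ..., v n, v 0.  Nonempty pairwise disjoint half-open edges
   [v i, v (i + 1)) say exactly that this curve is simple (and force at least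
   three vertices).  The only bounded regular closed set whose boundary is a
   simple closed curve is the union of the curve and its inside. *)
Definition simple_polygon (R : realType) (n : nat) (v : 'I_n -> plane R)
    (P : set (plane R)) : Prop :=
  [/\ (0 < n)%N /\ (forall i, v i != v (ordS i)),
      forall i j, i != j ->
        subsegment `[0, 1[ (v i) (v (ordS i)) `&`
        subsegment `[0, 1[ (v j) (v (ordS j)) = set0,
      bounded_set P,
      closure (interior P) = P
    & boundary P = \bigcup_i segment (v i) (v (ordS i))].

Definition rational_point (R : realType) (x : plane R) : Prop :=
  exists q : 'rV[rat]_2, x = map_mx ratr q.

Definition rational_polygon (R : realType) (P : set (plane R)) : Prop :=
  exists (n : nat) (v : 'I_n -> plane R),
    simple_polygon v P /\ forall i, rational_point (v i).

(* A boundary inside the annulus alone would also allow a polygon that does not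
   surround the origin, whence the explicit inclusions. *)
Definition approx_disk (R : realType) (a b : R) (P : set (plane R)) : Prop :=
  [/\ rational_polygon P,
      boundary P `<=` [set x | a <= enorm x <= b],
      disk 0 a `<=` P
    & P `<=` disk 0 b].

Variant answer := YES | NO | UNDECIDED.

Definition Decide (R : realType) (Q : set (plane R)) (r eps : R) : answer :=
  let Qeps := offset Q eps in
  let Pi := inset Qeps r in
  let Q' := offset Pi (r + eps) in
  if `[< Q `<=` Q' >] then YES else NO.

Definition eps_hat (R : realType) (Q : set (plane R)) (r : R) : R :=
  inf [set eps | 0 < eps /\ Decide Q r eps = YES].

(* Dbar a b is the polygon chosen by the algorithm between the circles of radii
   a and b; it is specified by [approx_disk] for 0 <= a < b only. *)
Definition ApproxDecideExterior (R : realType) (Dbar : R -> R -> set (plane R))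
    (Q : set (plane R)) (r eps delta : R) : answer :=
  let Qeps := minkowski Q (Dbar eps (eps + delta)) in
  let Pi := ~` minkowski (~` Qeps) (Dbar (r - delta) r) in
  let Q' := minkowski Pi (Dbar (r + eps) (r + eps + delta)) in
  if `[< Q `<=` Q' >] then UNDECIDED else NO.

(* Main.v *)
(* If the approximate algorithm accepted, then Decide would accept the larger
   parameter eps + 2 delta, contradicting eps + 2 delta < eps_hat: the outer
   polygons are contained in disks whose radii are larger by at most delta, and
   the loss of delta in the radius of the inset disk is paid for by one more
   delta in the first offset, since D_r = D_(r - delta) (+) D_delta. *)
Require Import Defs.
From HB Require Import structures.
From mathcomp Require Import all_boot all_order all_algebra.
From mathcomp Require Import all_classical all_reals all_analysis.
From mathcomp Require Import lra.

Set Implicit Arguments.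
Unset Strict Implicit.
Unset Printing Implicit Defensive.

Import Order.TTheory GRing.Theory Num.Theory.
Import numFieldNormedType.Exports.

Local Open Scope classical_set_scope.
Local Open Scope ring_scope.

Section EuclideanDisks.
Variable R : realType.
Implicit Types (x y c : plane R) (A B X Y : set (plane R)) (r s t : R).

Lemma enorm_ge0 x : 0 <= enorm x.
Proof. exact: sqrtr_ge0. Qed.

Lemma enorm0 : enorm (0 : plane R) = 0.
Proof. by rewrite /enorm big1 ?sqrtr0// => i _; rewrite mxE expr0n. Qed.

Lemma enormZ t x : 0 <= t -> enorm (t *: x) = t * enorm x.
Proof.
move=> t0; rewrite /enorm -{2}(ger0_norm t0) -sqrtr_sqr -sqrtrM ?sqr_ge0// mulr_sumr.
by congr Num.sqrt; apply: eq_bigr => i _; rewrite mxE exprMn.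
Qed.

(** Squaring reduces this to Cauchy-Schwarz, which in the plane follows from Lagrange's identity
    [(ac + bd)^2 + (ad - bc)^2 = (a^2 + b^2)(c^2 + d^2)]. *)
Lemma ler_enormD x y : enorm (x + y) <= enorm x + enorm y.
Proof.
have sq (z : plane R) : enorm z ^+ 2 = z ord0 ord0 ^+ 2 + z ord0 ord_max ^+ 2.
  rewrite /enorm sqr_sqrtr ?sumr_ge0// => [|i _]; last exact: sqr_ge0.
  by rewrite big_ord_recr big_ord1/=; congr (z _ _ ^+ 2 + _); apply: val_inj.
have x0 := enorm_ge0 x; have y0 := enorm_ge0 y.
rewrite -(@ler_pXn2r _ 2)// ?nnegrE ?addr_ge0 ?enorm_ge0// sqrrD.
have := sq (x + y); rewrite !mxE => ->; rewrite !sq.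
set a := x _ _; set b := x _ _; set c := y _ _; set d := y _ _.
suff : a * c + b * d <= enorm x * enorm y by lra.
apply: le_trans (ler_norm _) _.
rewrite -(@ler_pXn2r _ 2)// ?nnegrE ?mulr_ge0// real_normK ?num_real//.
rewrite exprMn !sq -/a -/b -/c -/d.
have := sqr_ge0 (a * d - b * c); lra.
Qed.

Lemma minkowskiS A B X Y :
  A `<=` X -> B `<=` Y -> Defs.minkowski A B `<=` Defs.minkowski X Y.
Proof.
move=> AX BY _ [a Aa [b Bb <-]].
by exists a; [exact: AX|exists b => //; exact: BY].
Qed.

Lemma subset_disk0 s t : s <= t -> disk (0 : plane R) s `<=` disk 0 t.
Proof. by move=> st x; rewrite /disk /= => /le_trans; apply. Qed.

Lemma minkowski_complS A B X Y : A `<=` X -> Y `<=` B ->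
  ~` Defs.minkowski (~` A) B `<=` ~` Defs.minkowski (~` X) Y.
Proof. by move=> AX YB; apply/subsetC/minkowskiS => //; exact: subsetC. Qed.

Lemma offset_offset X s t : offset (offset X s) t `<=` offset X (s + t).
Proof.
move=> _ [_ [x Xx [a + <-]] [b + <-]]; rewrite /disk /= !subr0 => ha hb.
exists x => //; exists (a + b); last by rewrite addrA.
by rewrite /disk /= subr0 (le_trans (ler_enormD _ _))// lerD.
Qed.

(** The vector [x - c] is cut in the ratio [s : t]; each piece is then no longer than its own
    radius. *)
Lemma disk_split c s t : 0 <= s -> 0 < t -> disk c (s + t) `<=` offset (disk c s) t.
Proof.
move=> s0 t0 x; rewrite /disk /= => xc.
have st0 : 0 < s + t by rewrite ltr_wpDl.
have scale u : 0 <= u -> enorm ((u / (s + t)) *: (x - c)) <= u.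
  move=> u0; rewrite enormZ ?divr_ge0 ?(ltW st0)//.
  by rewrite mulrAC ler_pdivrMr// ler_wpM2l.
exists (c + (s / (s + t)) *: (x - c)); first by rewrite /disk /= addrC addKr scale.
exists ((t / (s + t)) *: (x - c)); first by rewrite /disk /= subr0 scale// ltW.
by rewrite -addrA -scalerDl -mulrDl divff ?gt_eqF// scale1r addrC subrK.
Qed.

(** If the disk of radius [s] around [x] fits in [X], thickening both by [t] makes the disk of
    radius [s + t] fit in the offset. *)
Lemma inset_offset X s t :
  0 <= s -> 0 < t -> inset X s `<=` inset (offset X t) (s + t).
Proof.
move=> s0 t0 x; rewrite !insetE /= => xX.
by apply: subset_trans (disk_split s0 t0) _; exact: minkowskiS.
Qed.

Lemma sub_inset_offset X s : X `<=` inset (offset X s) s.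
Proof.
move=> x Xx; rewrite insetE => y /= yx; exists x => //; exists (y - x).
  by rewrite /disk /= subr0.
by rewrite addrC subrK.
Qed.

Lemma sub_offset X s : 0 <= s -> X `<=` offset X s.
Proof.
move=> s0 x Xx; exists x => //; exists 0; last by rewrite addr0.
by rewrite /disk /= subr0 enorm0.
Qed.

Lemma eps_hat_le X r s : 0 < s ->
  X `<=` offset (inset (offset X s) r) (r + s) -> eps_hat X r <= s.
Proof.
(* An infimum is below a member only for a set bounded below; here [0] is a lower bound. *)
move=> s0 XX; apply: ge_inf; first by exists 0 => t [/ltW].
by split=> //; rewrite /Decide asboolT.
Qed.

Lemma eps_hat_le_radius X r : 0 < r -> eps_hat X r <= r.
Proof.
move=> r0; apply: eps_hat_le => //.
apply: subset_trans (@sub_inset_offset X r) _.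
by apply: sub_offset; rewrite addr_ge0// ltW.
Qed.

End EuclideanDisks.

Theorem theorem13 (R : realType) (Dbar : R -> R -> set (plane R))
    (hDbar : forall a b : R, 0 <= a -> a < b -> approx_disk a b (Dbar a b))
    (Q : set (plane R)) (hQ : polygonal_region Q) (bQ : bounded_set Q)
    (r : R) (hr : 0 < r)
    (eps : R) (heps0 : 0 < eps) (heps : eps < eps_hat Q r)
    (delta : R) (hdelta0 : 0 < delta) (hdelta : delta < (eps_hat Q r - eps) / 2) :
  ApproxDecideExterior Dbar Q r eps delta = NO.
Proof.
(* This makes [r - delta] an admissible inner radius for [hDbar]. *)
have delta_r : delta < r by have := eps_hat_le_radius Q hr; lra.
rewrite /ApproxDecideExterior; case: asboolP => // QQ'; exfalso.
suff : eps_hat Q r <= eps + delta + delta by lra.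
apply: eps_hat_le; first lra.
(* The two offset polygons are bounded from outside, the inset polygon from inside: a smaller
   eroding set leaves a larger inset. *)
have [||_ _ _ Deps] := hDbar eps (eps + delta); [lra|lra|].
have [||_ _ Dr _] := hDbar (r - delta) r; [lra|lra|].
have [||_ _ _ Dout] := hDbar (r + eps) (r + eps + delta); [lra|lra|].
(* The last radius has slack: [r + eps + delta] is below [r + (eps + delta + delta)]. *)
apply: subset_trans QQ' _; apply: minkowskiS; last first.
  by apply: subset_trans Dout _; apply: subset_disk0; lra.
have Qeps : Defs.minkowski Q (Dbar eps (eps + delta)) `<=` offset Q (eps + delta).
  exact: minkowskiS.
apply: subset_trans (minkowski_complS Qeps Dr) _.
(* The inset radius is raised from [r - delta] to [r] by a further offset by [delta], which then
   merges with the first offset. *)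
have rd0 : 0 <= r - delta by lra.
apply: subset_trans (inset_offset rd0 hdelta0) _.
by rewrite subrK; apply: minkowski_complS => //; exact: offset_offset.
Qed.
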